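(* Let $\bar\zeta=(\bar\tau,\bar\sigma)\in\mathcal{S}_a$ be a critical point of $\Pi^d$ and let $\bar x=G(\bar\zeta)^{-1}f$. Then the following hold. 1. (Min-max duality) If $\bar\zeta$ satisfies $\Delta(\bar\zeta)>0$, then $$\Pi(\bar x)=\min_{x\in\mathbb{R}^n}\Pi(x)=\max_{\zeta\in\mathcal{S}_a^+}\Pi^d(\zeta)=\Pi^d(\bar\zeta).$$ 2. (Double-max duality) If $\bar\zeta\in\mathcal{S}_a^-$, and if $\bar x$ is a local maximizer of $\Pi$ or $\bar\zeta$ is a local maximizer of $\Pi^d$, then there exist a neighborhood $\mathcal{X}_0\subset\mathbb{R}^n$ of $\bar x$ and a neighborhood $\mathcal{S}_0\subset\mathcal{S}_a^-$ of $\bar\zeta$ such that $$\Pi(\bar x)=\max_{x\in\mathcal{X}_0}\Pi(x)=\max_{\zeta\in\mathcal{S}_0}\Pi^d(\zeta)=\Pi^d(\bar\zeta).$$ 3. (Double-min duality) If $\bar\zeta\in\mathcal{S}_a^-$ and $m=n$, and if $\bar x$ is a local minimizer of $\Pi$ or $\bar\zeta$ is a local minimizer of $\Pi^d$, then there exist a neighborhood $\mathcal{X}_0\subset\mathbb{R}^n$ of $\bar x$ and a neighborhood $\mathcal{S}_0\subset\mathcal{S}_a^-$ of $\bar\zeta$ such that $$\Pi(\bar x)=\min_{x\in\mathcal{X}_0}\Pi(x)=\min_{\zeta\in\mathcal{S}_0}\Pi^d(\zeta)=\Pi^d(\bar\zeta).$$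
   Context: Let $n,p,r$ be positive integers and $m=p+r$. Let $A_1,\dots,A_p\in\mathbb{R}^{n\times n}$ be symmetric matrices, $B_1,\dots,B_r\in\mathbb{R}^{n\times n}$ symmetric positive definite matrices, $C\in\mathbb{R}^{n\times n}$ a symmetric positive definite matrix, $f\in\mathbb{R}^n$, and $\alpha_1,\dots,\alpha_p,\beta_1,\dots,\beta_r\in\mathbb{R}$. The primal function $\Pi:\mathbb{R}^n\to\mathbb{R}$ is $$\Pi(x)=\sum_{i=1}^p\exp\left(\tfrac12x^TA_ix-\alpha_i\right)+\sum_{j=1}^r\tfrac12\left(\tfrac12x^TB_jx-\beta_j\right)^2-\tfrac12x^TCx-f^Tx.$$ Dual variables are $\zeta=(\tau,\sigma)\in\mathcal{E}_a^*=\{(\tau,\sigma)\in\mathbb{R}^p\times\mathbb{R}^r:\ \tau_i>0,\ i=1,\dots,p\}\subset\mathbb{R}^m$. Set $$G(\zeta)=\sum_{i=1}^p\tau_iA_i+\sum_{j=1}^r\sigma_jB_j-C,\qquad \mathcal{S}_a=\{\zeta\in\mathcal{E}_a^*:\det G(\zeta)\neq0\},$$ $$\mathcal{S}_a^+=\{\zeta\in\mathcal{S}_a: G(\zeta)\succ0\},\qquad \mathcal{S}_a^-=\{\zeta\in\mathcal{S}_a: G(\zeta)\prec0\},$$ where $\succ0$ and $\prec0$ mean positive definite and negative definite. The canonical dual function $\Pi^d:\mathcal{S}_a\to\mathbb{R}$ is $$\Pi^d(\zeta)=-\tfrac12f^TG(\zeta)^{-1}f-\sum_{i=1}^p(\alpha_i+\ln\tau_i-1)\tau_i-\sum_{j=1}^r\left(\tfrac12\sigma_j^2+\beta_j\sigma_j\right).$$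 A critical point of $\Pi^d$ is a point $\zeta\in\mathcal{S}_a$ with $\nabla\Pi^d(\zeta)=0$. For a symmetric matrix $M$ let $\lambda^M_{\min}$ and $\lambda^M_{\max}$ be its smallest and largest eigenvalues. For $\zeta=(\tau,\sigma)$ put $\bar\lambda^{B_j}=\lambda^{B_j}_{\min}$ if $\sigma_j>0$ and $\bar\lambda^{B_j}=\lambda^{B_j}_{\max}$ if $\sigma_j\le0$, and $$\Delta(\zeta)=\sum_{i=1}^p\tau_i\lambda^{A_i}_{\min}+\sum_{j=1}^r\sigma_j\bar\lambda^{B_j}-\lambda^{C}_{\max}.$$ *)

(* Defs.v *)
From HB Require Import structures.
From mathcomp Require Import all_boot all_order all_algebra.
From mathcomp Require Import all_classical all_reals all_analysis.

Set Implicit Arguments.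
Unset Strict Implicit.
Unset Printing Implicit Defensive.

Import Order.TTheory GRing.Theory Num.Theory.
Import numFieldNormedType.Exports.

Local Open Scope classical_set_scope.
Local Open Scope ring_scope.

Definition quad (R : realType) (n : nat) (M : 'M[R]_n) (x : 'cV[R]_n) : R :=
  (x^T *m M *m x) 0 0.

Definition posdefmx (R : realType) (n : nat) (M : 'M[R]_n) : Prop :=
  M \is symmetricmx /\ forall x : 'cV[R]_n, x != 0 -> 0 < quad M x.

Definition negdefmx (R : realType) (n : nat) (M : 'M[R]_n) : Prop :=
  M \is symmetricmx /\ forall x : 'cV[R]_n, x != 0 -> quad M x < 0.

(* The spectrum of a matrix is finite, and it is nonempty for a symmetric real
   matrix of positive size, so that inf and sup below are a minimum and a
   maximum in the only case in which they are used. *)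
Definition lambda_min (R : realType) (n : nat) (M : 'M[R]_n) : R :=
  inf [set a | eigenvalue M a].

Definition lambda_max (R : realType) (n : nat) (M : 'M[R]_n) : R :=
  sup [set a | eigenvalue M a].

(* "max_(x in D) g x = v": the supremum is v and it is attained in D. *)
Definition is_max_value (R : realType) (T : Type) (g : T -> R) (D : set T)
    (v : R) : Prop :=
  (g @` D) v /\ ubound (g @` D) v.

Definition is_min_value (R : realType) (T : Type) (g : T -> R) (D : set T)
    (v : R) : Prop :=
  (g @` D) v /\ lbound (g @` D) v.

Definition local_maximizer (R : realType) (T : topologicalType) (g : T -> R)
    (D : set T) (x : T) : Prop :=
  D x /\ \forall y \near within D (nbhs x), g y <= g x.

Definition local_minimizer (R : realType) (T : topologicalType) (g : T -> R)
    (D : set T) (x : T) : Prop :=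
  D x /\ \forall y \near within D (nbhs x), g x <= g y.

Definition gradient (R : realType) (m : nat) (g : 'cV[R]_m -> R)
    (z : 'cV[R]_m) : 'cV[R]_m :=
  \col_i 'D_(delta_mx i 0) g z.

Definition primal (R : realType) (n p r : nat)
    (A : 'I_p -> 'M[R]_n) (B : 'I_r -> 'M[R]_n) (C : 'M[R]_n) (f : 'cV[R]_n)
    (alpha : 'I_p -> R) (beta : 'I_r -> R) (x : 'cV[R]_n) : R :=
  \sum_(i < p) expR (2^-1 * quad (A i) x - alpha i)
  + \sum_(j < r) 2^-1 * (2^-1 * quad (B j) x - beta j) ^+ 2
  - 2^-1 * quad C x - (f^T *m x) 0 0.

(* A dual variable zeta = (tau, sigma) is a single vector of R^(p + r); tau is
   its upper block and sigma its lower block. *)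
Definition tau (R : realType) (p r : nat) (z : 'cV[R]_(p + r)) (i : 'I_p) : R :=
  usubmx z i 0.

Definition sigma (R : realType) (p r : nat) (z : 'cV[R]_(p + r)) (j : 'I_r) : R :=
  dsubmx z j 0.

Definition Gmx (R : realType) (n p r : nat)
    (A : 'I_p -> 'M[R]_n) (B : 'I_r -> 'M[R]_n) (C : 'M[R]_n)
    (z : 'cV[R]_(p + r)) : 'M[R]_n :=
  \sum_(i < p) tau z i *: A i + \sum_(j < r) sigma z j *: B j - C.

Definition Sa (R : realType) (n p r : nat)
    (A : 'I_p -> 'M[R]_n) (B : 'I_r -> 'M[R]_n) (C : 'M[R]_n) :
    set 'cV[R]_(p + r) :=
  [set z | (forall i, 0 < tau z i) /\ \det (Gmx A B C z) != 0].

Definition Sa_pos (R : realType) (n p r : nat)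
    (A : 'I_p -> 'M[R]_n) (B : 'I_r -> 'M[R]_n) (C : 'M[R]_n) :
    set 'cV[R]_(p + r) :=
  [set z | Sa A B C z /\ posdefmx (Gmx A B C z)].

Definition Sa_neg (R : realType) (n p r : nat)
    (A : 'I_p -> 'M[R]_n) (B : 'I_r -> 'M[R]_n) (C : 'M[R]_n) :
    set 'cV[R]_(p + r) :=
  [set z | Sa A B C z /\ negdefmx (Gmx A B C z)].

(* Total function on R^(p + r), meaningful only on Sa: outside Sa, invmx and ln
   take default values. *)
Definition dual (R : realType) (n p r : nat)
    (A : 'I_p -> 'M[R]_n) (B : 'I_r -> 'M[R]_n) (C : 'M[R]_n) (f : 'cV[R]_n)
    (alpha : 'I_p -> R) (beta : 'I_r -> R) (z : 'cV[R]_(p + r)) : R :=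
  - (2^-1 * quad (invmx (Gmx A B C z)) f)
  - \sum_(i < p) (alpha i + ln (tau z i) - 1) * tau z i
  - \sum_(j < r) (2^-1 * sigma z j ^+ 2 + beta j * sigma z j).

(* Sa is open and dual is smooth on it, so the partial derivatives taken in
   R^(p + r) are those of the restriction of dual to Sa. *)
Definition dual_critical (R : realType) (n p r : nat)
    (A : 'I_p -> 'M[R]_n) (B : 'I_r -> 'M[R]_n) (C : 'M[R]_n) (f : 'cV[R]_n)
    (alpha : 'I_p -> R) (beta : 'I_r -> R) (z : 'cV[R]_(p + r)) : Prop :=
  Sa A B C z /\ gradient (dual A B C f alpha beta) z = 0.

Definition Delta (R : realType) (n p r : nat)
    (A : 'I_p -> 'M[R]_n) (B : 'I_r -> 'M[R]_n) (C : 'M[R]_n)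
    (z : 'cV[R]_(p + r)) : R :=
  \sum_(i < p) tau z i * lambda_min (A i)
  + \sum_(j < r) sigma z j *
      (if 0 < sigma z j then lambda_min (B j) else lambda_max (B j))
  - lambda_max C.

(* Main.v *)
Require Import Defs.
From HB Require Import structures.
From mathcomp Require Import all_boot all_order all_algebra.
From mathcomp Require Import all_classical all_reals all_analysis.
From mathcomp Require Import ring lra.

Set Implicit Arguments.
Unset Strict Implicit.
Unset Printing Implicit Defensive.

Import Order.TTheory GRing.Theory Num.Theory.
Import numFieldNormedType.Exports.

(** Let [Xi x z = x^T G(z) x / 2 - f^T x - V^*(z)] be the total complementary
    function.  By Fenchel's inequality [Pi x = max_z Xi x z], attained exactly
    at [z = dual_of x], and [Pid z] is the value of [Xi _ z] at its stationary
    point [G(z)^-1 f], a minimum if [G(z)] is positive definite and a maximum if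
    it is negative definite; criticality of [zb] says that [zb = dual_of xb].
    This gives weak duality for the min-max statement.  Near [(xb, zb)] with
    [G] negative definite, [Xi x z] is at most [Pi x] and at most [Pid z], so
    local maximality is carried from one function to the other by the
    continuous maps [dual_of] and [z |-> G(z)^-1 f].  Local minimality is
    carried the other way as soon as these maps are locally onto, which holds
    for [p + r = n] because a local minimum forces the square matrix with rows
    [(A_i xb)^T, (B_j xb)^T] to be invertible. *)

Local Open Scope classical_set_scope.
Local Open Scope ring_scope.

(** * Limits of matrix-valued functions along a filter *)

Lemma cvg_mx (K : numFieldType) (T : Type) (F : set_system T) {FF : Filter F}
    (m n : nat) (M : T -> 'M[K]_(m, n)) (L : 'M[K]_(m, n)) :
  (forall i j, M t i j @[t --> F] --> L i j) -> M t @[t --> F] --> L.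
Proof.
(* A neighbourhood of [L] contains a product of neighbourhoods [P i j] of its entries, and there are
   finitely many of them. *)
move=> cvM A [P LP sPA].
have : \forall t \near F, forall i j, P i j (M t i j).
  by apply: filter_forall => i; apply: filter_forall => j; exact/cvM/LP.
by apply: filterS => t Pt; apply: sPA.
Qed.

Lemma cvg_mx_entry (K : numFieldType) (T : Type) (F : set_system T)
    {FF : Filter F} (m n : nat) (M : T -> 'M[K]_(m, n)) (L : 'M[K]_(m, n)) i j :
  M t @[t --> F] --> L -> M t i j @[t --> F] --> L i j.
Proof. by move=> cvM; exact: (cvg_comp _ _ cvM (@coord_continuous K m n i j L)). Qed.

Lemma cvg_bigsum (K : numFieldType) (T I : Type) (F : set_system T)
    {FF : Filter F} (r : seq I) (P : pred I) (g : I -> T -> K) (l : I -> K) :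
  (forall i, P i -> g i t @[t --> F] --> l i) ->
  \sum_(i <- r | P i) g i t @[t --> F] --> \sum_(i <- r | P i) l i.
Proof. by apply: cvg_big; exact: add_continuous. Qed.

Lemma cvg_bigprod (K : numFieldType) (T I : Type) (F : set_system T)
    {FF : Filter F} (r : seq I) (P : pred I) (g : I -> T -> K) (l : I -> K) :
  (forall i, P i -> g i t @[t --> F] --> l i) ->
  \prod_(i <- r | P i) g i t @[t --> F] --> \prod_(i <- r | P i) l i.
Proof. by apply: cvg_big; exact: mul_continuous. Qed.

Lemma cvg_trmx (K : numFieldType) (T : Type) (F : set_system T) {FF : Filter F}
    (m n : nat) (M : T -> 'M[K]_(m, n)) (L : 'M[K]_(m, n)) :
  M t @[t --> F] --> L -> (M t)^T @[t --> F] --> L^T.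
Proof.
move=> cvM; apply: cvg_mx => i j; rewrite mxE.
by under eq_cvg do rewrite mxE; exact: cvg_mx_entry.
Qed.

Lemma cvg_mulmx (K : numFieldType) (T : Type) (F : set_system T)
    {FF : Filter F} (m n p : nat) (M : T -> 'M[K]_(m, n)) (N : T -> 'M[K]_(n, p))
    (L : 'M[K]_(m, n)) (L' : 'M[K]_(n, p)) :
  M t @[t --> F] --> L -> N t @[t --> F] --> L' ->
  M t *m N t @[t --> F] --> L *m L'.
Proof.
move=> cvM cvN; apply: cvg_mx => i j; rewrite mxE.
under eq_cvg do rewrite mxE.
by apply: cvg_bigsum => k _; apply: cvgM; exact: cvg_mx_entry.
Qed.

Lemma cvg_det (K : numFieldType) (T : Type) (F : set_system T) {FF : Filter F}
    (n : nat) (M : T -> 'M[K]_n) (L : 'M[K]_n) :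
  M t @[t --> F] --> L -> \det (M t) @[t --> F] --> \det L.
Proof.
move=> cvM; apply: cvg_bigsum => s _; apply: cvgM; first exact: cvg_cst.
by apply: cvg_bigprod => i _; exact: cvg_mx_entry.
Qed.

(** Cramer's formula is continuous where the determinant is nonzero. Since [invmx] returns its
    argument on singular matrices, the formula is only eventually equal to [invmx (M t)]. *)
Lemma cvg_invmx (K : numFieldType) (T : Type) (F : set_system T) {FF : Filter F}
    (n : nat) (M : T -> 'M[K]_n) (L : 'M[K]_n) :
  L \in unitmx -> M t @[t --> F] --> L -> invmx (M t) @[t --> F] --> invmx L.
Proof.
rewrite unitmxE unitfE => detL cvM.
have cvdet : \det (M t) @[t --> F] --> \det L by exact: cvg_det.
have adj_cvg : (\det (M t))^-1 *: \adj (M t) @[t --> F] --> invmx L.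
  rewrite /invmx unitmxE unitfE detL /=; apply: cvgZ; first exact: cvgV.
  apply: cvg_mx => i j; rewrite mxE; under eq_cvg do rewrite mxE.
  apply: cvgM; first exact: cvg_cst.
  apply: cvg_det; apply: cvg_mx => k l; rewrite !mxE.
  by under eq_cvg do rewrite !mxE; exact: cvg_mx_entry.
apply: cvg_trans adj_cvg; apply: near_eq_cvg.
near=> t; rewrite /invmx unitmxE unitfE ifT //.
near: t; exact: cvgr_neq0 cvdet detL.
Unshelve. all: by end_near. Qed.

(** * Bilinear and quadratic forms, extreme eigenvalues and definiteness *)

Definition bil (R : realType) (n : nat) (M : 'M[R]_n) (x y : 'cV[R]_n) : R :=
  (x^T *m M *m y) 0 0.

Section quadratic_forms.
Variables (R : realType) (n : nat).
Implicit Types (M N : 'M[R]_n) (x y : 'cV[R]_n).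

Lemma bilDl M x y z : bil M (x + y) z = bil M x z + bil M y z.
Proof. by rewrite /bil linearD /= !mulmxDl mxE. Qed.

Lemma bilDr M x y z : bil M z (x + y) = bil M z x + bil M z y.
Proof. by rewrite /bil mulmxDr mxE. Qed.

Lemma bilZl M a x y : bil M (a *: x) y = a * bil M x y.
Proof. by rewrite /bil linearZ /= -!scalemxAl mxE. Qed.

Lemma bilNl M x y : bil M (- x) y = - bil M x y.
Proof. by rewrite -scaleN1r bilZl mulN1r. Qed.

Lemma bilZr M a x y : bil M x (a *: y) = a * bil M x y.
Proof. by rewrite /bil -scalemxAr mxE. Qed.

Lemma bilDmx M N x y : bil (M + N) x y = bil M x y + bil N x y.
Proof. by rewrite /bil mulmxDr mulmxDl mxE. Qed.

Lemma bilZmx a M x y : bil (a *: M) x y = a * bil M x y.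
Proof. by rewrite /bil -scalemxAr -scalemxAl mxE. Qed.

Lemma bil_summx (I : Type) (r : seq I) (F : I -> 'M[R]_n) x y :
  bil (\sum_(i <- r) F i) x y = \sum_(i <- r) bil (F i) x y.
Proof. by rewrite /bil mulmx_sumr mulmx_suml summxE. Qed.

Lemma symmx_tr M : M \is symmetricmx -> M^T = M.
Proof. by move=> /is_hermitianmxP; rewrite expr0 scale1r map_mx_id. Qed.

Lemma tr_symmx M : M^T = M -> M \is symmetricmx.
Proof. by move=> symM; apply/is_hermitianmxP; rewrite expr0 scale1r map_mx_id. Qed.

Lemma bilC M x y : M \is symmetricmx -> bil M x y = bil M y x.
Proof.
move=> /symmx_tr symM; rewrite /bil -[in LHS](trmxK (_ *m y)) mxE.
by rewrite !trmx_mul trmxK symM mulmxA.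
Qed.

Lemma quadDmx M N x : quad (M + N) x = quad M x + quad N x.
Proof. by rewrite /quad mulmxDr mulmxDl mxE. Qed.

Lemma quadZmx a M x : quad (a *: M) x = a * quad M x.
Proof. by rewrite /quad -scalemxAr -scalemxAl mxE. Qed.

Lemma quadNmx M x : quad (- M) x = - quad M x.
Proof. by rewrite -scaleN1r quadZmx mulN1r. Qed.

Lemma quad_summx (I : Type) (r : seq I) (F : I -> 'M[R]_n) x :
  quad (\sum_(i <- r) F i) x = \sum_(i <- r) quad (F i) x.
Proof.
by rewrite /quad mulmx_sumr mulmx_suml summxE.
Qed.

Lemma quadD M x y : M \is symmetricmx ->
  quad M (x + y) = quad M x + 2 * bil M y x + quad M y.
Proof.
(* [quad M x] is convertible to [bil M x x], so bilinearity applies. *)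
move=> symM; rewrite -[LHS]/(bil M _ _) bilDl !bilDr (bilC x y symM).
by rewrite /quad /bil; ring.
Qed.

Lemma quadZ M a x : quad M (a *: x) = a ^+ 2 * quad M x.
Proof. by rewrite -[LHS]/(bil M _ _) bilZl bilZr mulrA. Qed.

Lemma quadN M x : quad M (- x) = quad M x.
Proof. by rewrite -scaleN1r quadZ sqrrN expr1n mul1r. Qed.

Lemma quad_mx1 x : quad 1%:M x = \sum_i x i 0 ^+ 2.
Proof. by rewrite /quad mulmx1 mxE; apply: eq_bigr => i _; rewrite mxE. Qed.

Lemma quad_mx1_ge0 x : 0 <= quad 1%:M x.
Proof. by rewrite quad_mx1; apply: sumr_ge0 => i _; exact: sqr_ge0. Qed.

Lemma quad_mx1_gt0 x : x != 0 -> 0 < quad 1%:M x.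
Proof.
move=> x0; rewrite lt0r quad_mx1_ge0 andbT; apply: contra x0.
rewrite quad_mx1 psumr_eq0; last by move=> i _; exact: sqr_ge0.
move=> /allP x0; apply/eqP/colP => i; rewrite mxE; apply/eqP.
by have := x0 i (mem_index_enum i); rewrite sqrf_eq0.
Qed.

Lemma sqr_entry_le x i : x i 0 ^+ 2 <= quad 1%:M x.
Proof.
by rewrite quad_mx1 (bigD1 i)//= lerDl; apply: sumr_ge0 => j _; exact: sqr_ge0.
Qed.

Lemma quad_le M x : `|quad M x| <= (\sum_i \sum_j `|M i j|) * quad 1%:M x.
Proof.
have -> : quad M x = \sum_i \sum_j M i j * (x i 0 * x j 0).
  rewrite /quad -mulmxA mxE; apply: eq_bigr => i _; rewrite !mxE mulr_sumr.
  by apply: eq_bigr => j _; ring.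
rewrite (le_trans (ler_norm_sum _ _ _))// mulr_suml ler_sum// => i _.
rewrite (le_trans (ler_norm_sum _ _ _))// mulr_suml ler_sum// => j _.
rewrite normrM ler_wpM2l// ler_norml.
(* The squares of [x i 0 + x j 0] and [x i 0 - x j 0] are nonnegative, which bounds the product of
   the entries by half the sum of their squares. *)
have xi := sqr_entry_le x i; have xj := sqr_entry_le x j.
have := sqr_ge0 (x i 0 - x j 0); have := sqr_ge0 (x i 0 + x j 0).
by rewrite !expr2 in xi xj *; move=> ? ?; apply/andP; split; lra.
Qed.

Lemma cvg_quad (T : Type) (F : set_system T) {FF : Filter F} (M : T -> 'M[R]_n)
    (x : T -> 'cV[R]_n) L y :
  M t @[t --> F] --> L -> x t @[t --> F] --> y ->
  quad (M t) (x t) @[t --> F] --> quad L y.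
Proof.
move=> cvM cvx; apply: cvg_mx_entry; apply: cvg_mulmx => //.
by apply: cvg_mulmx => //; exact: cvg_trmx.
Qed.

(* A minimiser c of the form on the unit sphere, with value a, makes M - a I
   positive semidefinite with c isotropic, and this puts c in its kernel. *)
Lemma rayleigh M : (0 < n)%N -> M \is symmetricmx ->
  eigenvalue M (lambda_min M) /\
  forall x, lambda_min M * quad 1%:M x <= quad M x.
Proof.
move=> n_gt0 symM.
(* The sphere consists of row vectors, the form used by [EVT_min_rV] and by [eigenvalueP]. *)
pose S := [set v : 'rV[R]_n | quad 1%:M v^T = 1].
have cvq N (v : 'rV[R]_n) : quad N (w : 'rV[R]_n)^T @[w --> v] --> quad N v^T.
  by apply: (@cvg_quad _ (nbhs v) _ (fun=> N) trmx);
    [exact: cvg_cst | apply: cvg_trmx; exact: cvg_id].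
have S0 : S !=set0.
  exists (delta_mx 0 (Ordinal n_gt0)).
  rewrite /S /= quad_mx1 (bigD1 (Ordinal n_gt0))//= big1 ?addr0 => [|i ne].
    by rewrite !mxE !eqxx expr1n.
  by rewrite !mxE (negPf ne) andbF expr0n.
have cS : compact S.
  apply: bounded_closed_compact.
    exists 1; split => // e e1 v Sv /=; rewrite (le_trans _ (ltW e1))//.
    rewrite [leLHS]mx_normrE; apply/bigmax_leP; split => // -[i j] _ /=.
    have := sqr_entry_le v^T j; rewrite mxE ord1 Sv => vj.
    by rewrite ler_norml; apply/andP; split; nra.
  by apply: (@preimage_closed _ _ (fun v => quad 1%:M v^T) [set 1]) => [v _|];
    [exact: cvq | exact: closed_eq].
have [c /set_mem Sc cmin] := EVT_min_rV S0 cS (continuous_subspaceT (cvq M)).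
pose a := quad M c^T.
have ale x : a * quad 1%:M x <= quad M x.
  have [->|x0] := eqVneq x 0.
    by rewrite /quad trmx0 !mul0mx mxE mulr0.
  have q0 := quad_mx1_gt0 x0.
  pose s := Num.sqrt (quad 1%:M x).
  have s0 : 0 < s by rewrite sqrtr_gt0.
  have s2 : s ^+ 2 = quad 1%:M x by rewrite sqr_sqrtr// ltW.
  have Sx : S (s^-1 *: x)^T.
    by rewrite /S /= trmxK quadZ -s2 exprVn mulVf// expf_neq0// gt_eqF.
  have := cmin _ (mem_set Sx); rewrite trmxK quadZ -/a exprVn s2.
  by rewrite ler_pdivlMl// mulrC.
pose N : 'M[R]_n := M - a%:M.
have quadN x : quad N x = quad M x - a * quad 1%:M x.
  by rewrite /N quadDmx quadNmx -(scalemx1 n a) quadZmx.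
have symN : N \is symmetricmx.
  by apply: tr_symmx; rewrite linearB /= tr_scalar_mx symmx_tr.
have cN : c *m N = 0.
  pose w := (c *m N)^T.
  have bw : bil N c^T w = quad 1%:M w.
    by rewrite /bil /quad mulmx1 trmxK /w !trmxK.
  apply/eqP/contraT => cN0.
  have w0 : 0 < quad 1%:M w.
    by apply: quad_mx1_gt0; rewrite trmx_eq0.
  pose s := quad 1%:M w; pose q := quad N w.
  have q_ge0 : 0 <= q by rewrite /q quadN subr_ge0.
  have pos t : 0 <= 2 * t * s + t ^+ 2 * q.
    have : 0 <= quad N (c^T + t *: w) by rewrite quadN subr_ge0.
    rewrite quadD// bilZl quadZ bilC// bw quadN -/a Sc -/s -/q; lra.
  (* This [t] makes the polynomial in [pos] negative; the [+ 1] keeps the denominator positive when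
     [q = 0]. *)
  have := pos (- s / (q + 1)).
  have q1 : 0 < q + 1 by lra.
  have -> : 2 * (- s / (q + 1)) * s + (- s / (q + 1)) ^+ 2 * q =
     - (s ^+ 2 / (q + 1)) * (1 + 1 / (q + 1)).
    by field; rewrite gt_eqF.
  have s2 : 0 < s ^+ 2 / (q + 1) by rewrite divr_gt0// exprn_gt0.
  have d1 : 0 < 1 + 1 / (q + 1) by rewrite addr_gt0// divr_gt0.
  by rewrite mulNr oppr_ge0 leNgt mulr_gt0.
have eva : eigenvalue M a.
  apply/eigenvalueP; exists c.
    by apply/eqP; rewrite -subr_eq0 -mul_mx_scalar -mulmxBr -/N cN.
  apply/eqP => c0; have := Sc; rewrite /S /= c0 trmx0 /quad mulmx0 mxE => /esym/eqP.
  by rewrite oner_eq0.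
have lb : lbound [set b | eigenvalue M b] a.
  move=> b /= /eigenvalueP[v vM v0].
  have v0' : 0 < quad 1%:M v^T.
    by apply: quad_mx1_gt0; rewrite trmx_eq0.
  have := ale v^T; rewrite /quad !trmxK vM mulmx1 -scalemxAl [leRHS]mxE.
  by rewrite /quad mulmx1 trmxK in v0'; rewrite ler_pM2r.
suff -> : lambda_min M = a by [].
apply/eqP; rewrite eq_le; apply/andP; split.
  by apply: ge_inf => //; exists a.
by apply: lb_le_inf => //; exists a.
Qed.

(** Negation exchanges the two spectra, and [inf] is by definition the opposite of the [sup] of the
    opposite set. This carries [rayleigh] over to the largest eigenvalue. *)
Lemma lambda_minN M : lambda_min (- M) = - lambda_max M.
Proof.
rewrite /lambda_min /lambda_max /inf; congr (- sup _).
apply/seteqP; split => [_ [b /eigenvalueP[v vM v0] <-]|b /eigenvalueP[v vM v0]] /=.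
  by apply/eigenvalueP; exists v => //; rewrite scaleNr -vM mulmxN opprK.
exists (- b); rewrite ?opprK//; apply/eigenvalueP; exists v => //.
by rewrite mulmxN vM scaleNr.
Qed.

Lemma symmxN M : M \is symmetricmx -> - M \is symmetricmx.
Proof. by move=> symM; apply: tr_symmx; rewrite linearN /= symmx_tr. Qed.

Lemma rayleigh_max M x : (0 < n)%N -> M \is symmetricmx ->
  quad M x <= lambda_max M * quad 1%:M x.
Proof.
move=> n_gt0 /symmxN /(rayleigh n_gt0) [_ /(_ x)].
by rewrite lambda_minN quadNmx mulNr lerN2.
Qed.

(** The constant is the least eigenvalue of [- M]; it is positive because the form of [- M] is
    positive at a corresponding eigenvector. *)
Lemma negdefmx_gap M : (0 < n)%N -> negdefmx M ->
  exists2 c, 0 < c & forall x, quad M x <= - c * quad 1%:M x.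
Proof.
move=> n_gt0 [symM negM]; have [/eigenvalueP[v vM v0] le] := rayleigh n_gt0 (symmxN symM).
exists (lambda_min (- M)); last first.
  by move=> x; rewrite mulNr lerNr -quadNmx; exact: le.
have vT0 : v^T != 0 by rewrite trmx_eq0.
have := negM _ vT0; rewrite -oppr_gt0 -quadNmx /quad trmxK vM -scalemxAl mxE => pos.
have := quad_mx1_gt0 vT0; rewrite /quad trmxK mulmx1 => q0.
by rewrite -(pmulr_lgt0 _ q0).
Qed.

(** The sum of the absolute values of the entries of [M t - L] controls its quadratic form by
    [quad_le], and it eventually falls below the gap of [L]. *)
Lemma near_negdefmx (T : Type) (F : set_system T) {FF : Filter F}
    (M : T -> 'M[R]_n) L : (0 < n)%N ->
  (forall t, M t \is symmetricmx) ->
  M t @[t --> F] --> L -> negdefmx L -> \forall t \near F, negdefmx (M t).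
Proof.
move=> n_gt0 symM cvM /(negdefmx_gap n_gt0)[c c0 cL].
have cvD : \sum_i \sum_j `|(M t - L) i j| @[t --> F] --> (0 : R).
  have LL0 : \sum_i \sum_j `|(L - L) i j| = 0.
    by rewrite subrr; apply: big1 => i _; apply: big1 => j _; rewrite mxE normr0.
  rewrite -[X in _ --> X]LL0.
  apply: cvg_bigsum => i _; apply: cvg_bigsum => j _; apply: cvg_norm.
  by apply: (@cvg_mx_entry _ _ _ _ _ _ (fun t => M t - L)); apply: cvgB => //;
    exact: cvg_cst.
near=> t; split => // x x0.
have Mt : \sum_i \sum_j `|(M t - L) i j| < c.
  by near: t; apply: cvgr_lt cvD _ c0.
rewrite -(subrK L (M t)) quadDmx.
have q0 := quad_mx1_gt0 x0.
have := quad_le (M t - L) x; have := cL x; have := ler_norm (quad (M t - L) x).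
nra.
Unshelve. all: by end_near. Qed.

Lemma posdefmx_unit M : posdefmx M -> M \in unitmx.
Proof.
move=> [_ posM]; rewrite -row_free_unit -kermx_eq0.
apply/contraT => /rowV0Pn[v /sub_kermxP vM v0].
have vT0 : v^T != 0 by rewrite trmx_eq0.
by have := posM _ vT0; rewrite /quad trmxK vM mul0mx mxE ltxx.
Qed.

Lemma negdefmx_unit M : negdefmx M -> M \in unitmx.
Proof.
move=> [_ negM]; rewrite -row_free_unit -kermx_eq0.
apply/contraT => /rowV0Pn[v /sub_kermxP vM v0].
have vT0 : v^T != 0 by rewrite trmx_eq0.
by have := negM _ vT0; rewrite /quad trmxK vM mul0mx mxE ltxx.
Qed.

End quadratic_forms.

(** * Estimates in the maximum norm and a fixed point theorem *)

Lemma sumr_const_ord (V : nmodType) (n : nat) (a : V) : \sum_(i < n) a = a *+ n.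
Proof. by rewrite sumr_const card_ord. Qed.

Lemma mx_norm_leP (R : realType) (m n : nat) (M : 'M[R]_(m, n)) (e : R) :
  0 <= e -> reflect (forall i j, `|M i j| <= e) (`|M| <= e).
Proof.
move=> e0; apply: (iffP idP) => [le i j | le].
  by move: le; rewrite [leLHS]mx_normrE => /bigmax_leP[_ /(_ (i, j) isT)].
by rewrite [leLHS]mx_normrE; apply/bigmax_leP; split => // -[i j] _; exact: le.
Qed.

Lemma normr_entry_le (R : realType) (m n : nat) (M : 'M[R]_(m, n)) i j :
  `|M i j| <= `|M|.
Proof. by move: i j; apply/mx_norm_leP. Qed.

Lemma norm_trmx_le (R : realType) (m n : nat) (M : 'M[R]_(m, n)) :
  `|M^T| <= `|M|.
Proof. by apply/mx_norm_leP => // i j; rewrite mxE normr_entry_le. Qed.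

(** The norm is the largest absolute value of an entry, whence the factor [n]: each entry of the
    product is a sum of [n] terms. *)
Lemma norm_mulmx (R : realType) (m n p : nat) (M : 'M[R]_(m, n))
    (N : 'M[R]_(n, p)) : `|M *m N| <= (`|M| * `|N|) *+ n.
Proof.
apply/mx_norm_leP => [|i j]; first by rewrite mulrn_wge0// mulr_ge0.
rewrite mxE (le_trans (ler_norm_sum _ _ _))//.
rewrite -[leRHS]sumr_const_ord ler_sum// => k _.
by rewrite normrM ler_pM// normr_entry_le.
Qed.

(* |Phi u - u| is minimal at a fixed point: applying Phi would halve it. *)
Lemma contraction_fixpoint (R : realType) (n : nat) (Phi : 'cV[R]_n -> 'cV[R]_n)
    (e : R) : 0 <= e -> continuous Phi ->
  (forall u, `|u| <= e -> `|Phi u| <= e) ->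
  (forall u v, `|u| <= e -> `|v| <= e -> `|Phi u - Phi v| <= 2^-1 * `|u - v|) ->
  exists2 u, `|u| <= e & Phi u = u.
Proof.
move=> e0 cPhi stab contr.
pose S := [set w : 'rV[R]_n | `|w^T| <= e].
have ctr (w : 'rV[R]_n) : (v^T) @[v --> w] --> w^T.
  by apply: (@cvg_trmx _ _ (nbhs w)); exact: cvg_id.
have cS : compact S.
  apply: bounded_closed_compact.
    exists e; split; first exact: num_real.
    move=> d ed w Sw /=; rewrite -[w]trmxK.
    by rewrite (le_trans (norm_trmx_le _))// (le_trans Sw)// ltW.
  apply: (@preimage_closed _ _ (fun w : 'rV[R]_n => `|w^T|) [set t | t <= e]).
    by move=> w _; apply: (@cvg_norm _ _ _ (nbhs w)); exact: ctr.
  exact: closed_le.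
have S0 : S !=set0 by exists 0; rewrite /S /= trmx0 normr0.
have cg : continuous (fun w : 'rV[R]_n => `|Phi w^T - w^T|).
  move=> w; apply: (@cvg_norm _ _ _ (nbhs w)).
  apply: (@cvgB _ _ _ (nbhs w)); last exact: ctr.
  exact: (cvg_comp _ _ (ctr w) (cPhi w^T)).
have [c /set_mem Sc cmin] := EVT_min_rV S0 cS (continuous_subspaceT cg).
exists c^T => //; apply/eqP; rewrite -subr_eq0 -normr_le0.
have SPhi : S (Phi c^T)^T by rewrite /S /= trmxK stab.
have := cmin _ (mem_set SPhi); rewrite trmxK.
have := contr _ _ (stab _ Sc) Sc; have := normr_ge0 (Phi c^T - c^T); lra.
Qed.

(** * Vector-valued quadratic maps and their local surjectivity *)

Definition quad_map (R : realType) (m n : nat) (D : 'I_m -> 'M[R]_n)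
    (x : 'cV[R]_n) : 'cV[R]_m :=
  \col_k (2^-1 * quad (D k) x).

Definition jac_mx (R : realType) (m n : nat) (D : 'I_m -> 'M[R]_n)
    (x : 'cV[R]_n) : 'M[R]_(m, n) :=
  \matrix_(k, i) (D k *m x) i 0.

Section quadratic_maps.
Variables (R : realType) (m n : nat) (D : 'I_m -> 'M[R]_n).
Hypothesis symD : forall k, D k \is symmetricmx.

Lemma quad_mapE x k : quad_map D x k 0 = 2^-1 * quad (D k) x.
Proof. by rewrite mxE. Qed.

Lemma jac_mxE x v k : (jac_mx D x *m v) k 0 = bil (D k) v x.
Proof.
rewrite /bil -mulmxA !mxE; apply: eq_bigr => i _.
by rewrite [in LHS]mxE [in RHS]mxE mulrC.
Qed.

Lemma jac_mx_tr x (eta : 'cV[R]_m) :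
  (jac_mx D x)^T *m eta = (\sum_k eta k 0 *: D k) *m x.
Proof.
rewrite mulmx_suml; apply/colP => i; rewrite mxE summxE; apply: eq_bigr => k _.
by rewrite -scalemxAl 2![in LHS]mxE [in RHS]mxE mulrC.
Qed.

Lemma cvg_jac_mx (T : Type) (F : set_system T) {FF : Filter F}
    (x : T -> 'cV[R]_n) (y : 'cV[R]_n) :
  x t @[t --> F] --> y -> jac_mx D (x t) @[t --> F] --> jac_mx D y.
Proof.
move=> cvx; apply: cvg_mx => k i; rewrite mxE; under eq_cvg do rewrite mxE.
by apply: cvg_mx_entry; apply: cvg_mulmx => //; exact: cvg_cst.
Qed.

Lemma continuous_quad_map : continuous (quad_map D).
Proof.
move=> x; apply: (@cvg_mx _ _ (nbhs x)) => k i; rewrite mxE; under eq_cvg do rewrite mxE.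
apply: cvgM; first exact: cvg_cst.
by apply: (@cvg_quad _ _ _ (nbhs x) _ (fun=> D k) id); [exact: cvg_cst | exact: cvg_id].
Qed.

(** The Taylor expansion at [x] is exact, with [jac_mx D x] as derivative and [quad_map D u] itself
    as second-order term. *)
Lemma quad_mapD x u :
  quad_map D (x + u) = quad_map D x + jac_mx D x *m u + quad_map D u.
Proof.
apply/colP => k; rewrite [RHS]mxE [(quad_map D x + _) k 0]mxE jac_mxE !quad_mapE.
by rewrite quadD//; move: (quad _ _) (bil _ _ _) (quad _ _) => a b c; field.
Qed.

(** The analogue of factoring a difference of squares. It makes [quad_map D] Lipschitz near [0] with
    an arbitrarily small constant. *)
Lemma quad_mapB u v :
  quad_map D u - quad_map D v = 2^-1 *: (jac_mx D (u + v) *m (u - v)).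
Proof.
apply/colP => k; rewrite [(quad_map D u - _) k 0]mxE [(- quad_map D v) k 0]mxE [RHS]mxE.
rewrite jac_mxE !quad_mapE.
rewrite bilDr !bilDl !bilNl (bilC v u (symD k)).
rewrite -[bil _ u u]/(quad (D k) u) -[bil _ v v]/(quad (D k) v).
by move: (quad _ u) (quad _ v) (bil _ _ _) => a b c; ring.
Qed.

Lemma norm_jac_mx x : `|jac_mx D x| <= (\sum_k `|D k|) * `|x| *+ n.
Proof.
apply/mx_norm_leP => [|k i].
  by rewrite mulrn_wge0// mulr_ge0// sumr_ge0.
rewrite mxE (le_trans (normr_entry_le _ _ _))// (le_trans (norm_mulmx _ _))//.
rewrite lerMn2r; apply/orP; right; rewrite ler_wpM2r//.
by rewrite (bigD1 k)//= lerDl sumr_ge0.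
Qed.

(** By [quad_mapD], a solution of [u = W *m (y - quad_map D x - quad_map D u)] gives
    [quad_map D (x + u) = y]. For [y] close to [quad_map D x] the right-hand side is a contraction
    of a small ball, so [contraction_fixpoint] applies. *)
Lemma quad_map_open x (W : 'M[R]_(n, m)) (X : set 'cV[R]_n) :
  jac_mx D x *m W = 1%:M -> nbhs x X ->
  \forall y \near quad_map D x, exists2 w, X w & quad_map D w = y.
Proof.
move=> JW /nbhs_ballP[e0 /= e0_gt0 ballX].
pose a := `|W| *+ m; pose K := (\sum_k `|D k|) *+ n *+ n.
have a_ge0 : 0 <= a by rewrite mulrn_wge0.
have K_ge0 : 0 <= K by rewrite !mulrn_wge0// sumr_ge0.
have aK_ge0 : 0 <= a * K by rewrite mulr_ge0.
have normW (v : 'cV[R]_m) : `|W *m v| <= a * `|v|.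
  by rewrite (le_trans (norm_mulmx _ _))// mulrnAl.
have norm_qB u v : `|quad_map D u - quad_map D v| <= K * `|u + v| * `|u - v|.
  rewrite quad_mapB normrZ ger0_norm ?invr_ge0//.
  have : `|jac_mx D (u + v) *m (u - v)| <= K * `|u + v| * `|u - v|.
    rewrite (le_trans (norm_mulmx _ _))// /K.
    rewrite !mulrnAl lerMn2r; apply/orP; right; rewrite -mulrnAl ler_wpM2r//.
    exact: norm_jac_mx.
  have := normr_ge0 (jac_mx D (u + v) *m (u - v)); lra.
(* The first bound keeps [x + u] in the ball contained in [X]. The second gives
   [a * K * (2 * e) <= 1 / 2], the contraction constant; its [+ 1] avoids a zero denominator. *)
pose e := Num.min (e0 / 2) (4 * (a * K + 1))^-1.
have e_gt0 : 0 < e.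
  by rewrite lt_min divr_gt0//= invr_gt0 mulr_gt0// ltr_wpDl.
have e_le : e * (a * K) <= 4^-1.
  have : e * (4 * (a * K + 1)) <= 1.
    by rewrite -ler_pdivlMr ?mul1r ?ge_min ?lexx ?orbT// mulr_gt0// ltr_wpDl.
  by have := ltW e_gt0; lra.
have e_lt : e < e0.
  have : e <= e0 / 2 by rewrite ge_min lexx.
  lra.
(* This radius yields [|Phi 0| <= e / 2]; the contraction contributes the other half of [e] in
   [stab]. *)
have yd : \forall y \near quad_map D x, `|y - quad_map D x| < e / (2 * (a + 1)).
  have d_gt0 : 0 < e / (2 * (a + 1)) by rewrite divr_gt0// mulr_gt0// ltr_wpDl.
  have := nbhsx_ballx (quad_map D x) _ d_gt0.
  by apply: filterS => y; rewrite -ball_normE /= distrC.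
apply: filterS yd => y yd.
have ayd : a * `|y - quad_map D x| <= e / 2.
  move: yd; rewrite ltr_pdivlMr ?mulr_gt0 ?ltr_wpDl// => yd.
  by have := normr_ge0 (y - quad_map D x); lra.
pose Phi u := W *m (y - quad_map D x - quad_map D u).
have cPhi : continuous Phi.
  move=> u; apply: (@cvg_mulmx _ _ (nbhs u)); first exact: cvg_cst.
  by apply: cvgB; [exact: cvg_cst | exact: continuous_quad_map].
have PhiB u v : Phi u - Phi v = W *m (quad_map D v - quad_map D u).
  by rewrite -mulmxBr; congr (_ *m _); rewrite opprB addrC addrA subrK.
have contr u v : `|u| <= e -> `|v| <= e -> `|Phi u - Phi v| <= 2^-1 * `|u - v|.
  move=> ue ve; rewrite PhiB (le_trans (normW _))//.
  have := norm_qB v u; have := ler_normD v u; rewrite (distrC v u).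
  have := normr_ge0 (u - v); have := normr_ge0 (v + u).
  set s := `|v + u|; set d := `|u - v|; set q := `|_ - _| => s0 d0 s_le q_le.
  have : a * q <= (a * K) * s * d by rewrite -!mulrA ler_wpM2l// mulrA.
  move=> /le_trans; apply; rewrite ler_wpM2r//.
  have : a * K * s <= a * K * (2 * e) by rewrite ler_wpM2l//; lra.
  lra.
have quad_map0 : quad_map D 0 = 0.
  by apply/colP => k; rewrite !mxE /quad mulmx0 mxE mulr0.
have stab u : `|u| <= e -> `|Phi u| <= e.
  move=> ue; have e0' := ltW e_gt0.
  have := contr u 0 ue; rewrite normr0 subr0 => /(_ e0') le1.
  have Phi0 : `|Phi 0| <= e / 2.
    by rewrite /Phi quad_map0 subr0 (le_trans (normW _)).
  have := ler_normD (Phi u - Phi 0) (Phi 0); rewrite subrK; lra.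
have [u ue uE] := contraction_fixpoint (ltW e_gt0) cPhi stab contr.
exists (x + u).
  apply: ballX; rewrite -ball_normE /ball_ /= opprD addrA subrr sub0r normrN.
  exact: le_lt_trans ue e_lt.
rewrite quad_mapD -[in jac_mx D x *m u]uE /Phi mulmxA JW mul1mx.
by rewrite -addrA subrK addrC subrK.
Qed.

End quadratic_maps.

(** Injectivity on columns gives rank [n], which for a square matrix is also full row rank. The
    resulting right inverse is what the double-min statement takes from the equality of
    dimensions. *)
Lemma row_free_of_inj (K : fieldType) (m n : nat) (M : 'M[K]_(m, n)) :
  m = n -> (forall v : 'cV[K]_n, M *m v = 0 -> v = 0) -> row_free M.
Proof.
move=> mn inj.
have : row_free M^T.
  rewrite -kermx_eq0; apply/contraT => /rowV0Pn[v /sub_kermxP vM /negP[]].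
  rewrite -trmx_eq0; apply/eqP/inj; apply: trmx_inj.
  by rewrite trmx_mul trmxK vM trmx0.
by rewrite /row_free mxrank_tr => /eqP rkM; apply/eqP; rewrite rkM mn.
Qed.

(** * Directional derivatives from slope functions *)

Lemma is_derive_line (R : realType) (m : nat) (g : 'cV[R]_m -> R)
    (z v : 'cV[R]_m) (s : R -> R) :
  (\forall h \near 0, g (h *: v + z) - g z = h * s h) ->
  s h @[h --> 0] --> s 0 -> is_derive z v g (s 0).
Proof.
move=> gs cs.
(* For small nonzero [h] the difference quotient is exactly [s h], so continuity of [s] at [0] gives
   its limit. *)
have cvd : h^-1 *: ((g \o shift z) (h *: v) - g z) @[h --> 0^'] --> s 0.
  have cs' : s h @[h --> 0^'] --> s 0 by move=> P /cs; exact: nbhs_dnbhs.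
  apply: cvg_trans cs'; apply: near_eq_cvg; near=> h.
  have h0 : h != 0 by near: h; exact: nbhs_dnbhs_neq.
  have /= -> : g (h *: v + z) - g z = h * s h by near: h; exact: nbhs_dnbhs.
  by rewrite /GRing.scale /= mulKf.
split; first by apply/cvg_ex; exists (s 0).
exact: cvg_lim cvd.
Unshelve. all: by end_near. Qed.

(** Carathéodory's criterion provides a continuous slope [H] for [theta], which supplies the
    factorisation required by [is_derive_line]. *)
Lemma is_derive_entry (R : realType) (m : nat) (theta : R -> R) (k : 'I_m)
    (z v : 'cV[R]_m) (d : R) :
  is_derive (z k 0) 1 theta d ->
  is_derive z v (fun w => theta (w k 0)) (v k 0 * d).
Proof.
move=> /is_derive1_caratheodory[H [HE cH <-]].
pose s h := v k 0 * H (h * v k 0 + z k 0).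
have -> : v k 0 * H (z k 0) = s 0 by rewrite /s mul0r add0r.
apply: is_derive_line.
  by near=> h; rewrite !mxE HE addrK /s; ring.
have cvl : h * v k 0 + z k 0 @[h --> 0] --> 0 * v k 0 + z k 0.
  apply: cvgD; last exact: cvg_cst.
  by apply: cvgM; [exact: cvg_id | exact: cvg_cst].
apply: cvgM; first exact: cvg_cst.
rewrite mul0r add0r in cvl *; exact: (cvg_comp _ _ cvl cH).
Unshelve. all: by end_near. Qed.

(** * The total complementary function and Fenchel's inequality *)

Section canonical_duality.
Variables (R : realType) (n p r : nat).
Variables (A : 'I_p -> 'M[R]_n) (B : 'I_r -> 'M[R]_n) (C : 'M[R]_n).
Variables (f : 'cV[R]_n) (alpha : 'I_p -> R) (beta : 'I_r -> R).
Hypothesis symA : forall i, A i \is symmetricmx.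
Hypothesis symB : forall j, B j \is symmetricmx.
Hypothesis symC : C \is symmetricmx.

Local Notation G := (Gmx A B C).
Local Notation Pi := (primal A B C f alpha beta).
Local Notation Pid := (dual A B C f alpha beta).

(** Both families under one index, so that [Gmx] is a single affine sum and the results on
    [quad_map] and [jac_mx] apply to it. *)
Definition ABmx (k : 'I_(p + r)) : 'M[R]_n :=
  match fintype.split k with inl i => A i | inr j => B j end.

Lemma ABmx_lshift i : ABmx (lshift r i) = A i.
Proof. by rewrite /ABmx (unsplitK (inl i)). Qed.

Lemma ABmx_rshift j : ABmx (rshift p j) = B j.
Proof. by rewrite /ABmx (unsplitK (inr j)). Qed.

Lemma symAB k : ABmx k \is symmetricmx.
Proof. by rewrite /ABmx; case: fintype.split. Qed.

Lemma tauE (z : 'cV[R]_(p + r)) i : tau z i = z (lshift r i) 0.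
Proof. by rewrite /tau mxE. Qed.

Lemma sigmaE (z : 'cV[R]_(p + r)) j : sigma z j = z (rshift p j) 0.
Proof. by rewrite /sigma mxE. Qed.

Lemma GmxE z : G z = \sum_k z k 0 *: ABmx k - C.
Proof.
rewrite big_split_ord /Gmx; congr (_ + _ - _); apply: eq_bigr => k _.
  by rewrite tauE ABmx_lshift.
by rewrite sigmaE ABmx_rshift.
Qed.

Lemma symG z : G z \is symmetricmx.
Proof.
apply: tr_symmx; rewrite GmxE linearB /= linear_sum /= (symmx_tr symC).
by congr (_ - _); apply: eq_bigr => k _; rewrite linearZ /= (symmx_tr (symAB k)).
Qed.

Lemma GmxD z w : G (z + w) = G z + \sum_k w k 0 *: ABmx k.
Proof.
rewrite !GmxE addrAC -big_split /=; congr (_ - _).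
by apply: eq_bigr => k _; rewrite mxE scalerDl.
Qed.

Lemma cvg_Gmx (T : Type) (F : set_system T) {FF : Filter F}
    (z : T -> 'cV[R]_(p + r)) (w : 'cV[R]_(p + r)) :
  z t @[t --> F] --> w -> G (z t) @[t --> F] --> G w.
Proof.
move=> cvz; apply: cvg_mx => a b; rewrite GmxE !mxE summxE.
under eq_cvg do rewrite GmxE !mxE summxE.
apply: cvgB; last exact: cvg_cst.
apply: cvg_bigsum => k _; rewrite mxE; under eq_cvg do rewrite mxE.
by apply: cvgM; [exact: cvg_mx_entry | exact: cvg_cst].
Qed.

(* Gao's total complementary function *)
Definition Xi (x : 'cV[R]_n) (z : 'cV[R]_(p + r)) : R :=
  2^-1 * quad (G z) x - (f^T *m x) 0 0
  - \sum_(i < p) (alpha i + ln (tau z i) - 1) * tau z i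
  - \sum_(j < r) (2^-1 * sigma z j ^+ 2 + beta j * sigma z j).

(** The gradient of the canonical energy, a sum of exponentials and half squares, at the shifted
    quadratic measures of [x]. *)
Definition dual_of (x : 'cV[R]_n) : 'cV[R]_(p + r) :=
  col_mx (\col_i expR (2^-1 * quad (A i) x - alpha i))
         (\col_j (2^-1 * quad (B j) x - beta j)).

Lemma tau_dual_of x i : tau (dual_of x) i = expR (2^-1 * quad (A i) x - alpha i).
Proof. by rewrite /tau col_mxKu mxE. Qed.

Lemma sigma_dual_of x j : sigma (dual_of x) j = 2^-1 * quad (B j) x - beta j.
Proof. by rewrite /sigma col_mxKd mxE. Qed.

Lemma eq_dual (z w : 'cV[R]_(p + r)) :
  (forall i, tau z i = tau w i) -> (forall j, sigma z j = sigma w j) -> z = w.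
Proof.
move=> eqt eqs; rewrite -[z]vsubmxK -[w]vsubmxK.
by congr col_mx; apply/colP => k; [exact: eqt | exact: eqs].
Qed.

(** This is [1 + d <= expR d] at [d = u - ln t], multiplied by [t]; it is strict unless [d = 0]. *)
Lemma fenchel_expR (t u : R) : 0 < t ->
  u * t - (ln t - 1) * t <= expR u ?= iff (t == expR u).
Proof.
move=> t_gt0; have [/eqP tE|tNe] := boolP (t == expR u).
  by rewrite tE expRK; apply/leifP/eqP; ring.
have : u - ln t != 0.
  by apply: contra tNe; rewrite subr_eq0 => /eqP ->; rewrite lnK.
move=> /expR_gt1Dx; rewrite expRD expRN lnK// ltr_pdivlMr// => lt.
by apply/leifP; lra.
Qed.

(** The two sides differ by half the square of [s - u]. *)
Lemma fenchel_sqr (s u : R) :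
  u * s - 2^-1 * s ^+ 2 <= 2^-1 * u ^+ 2 ?= iff (s == u).
Proof.
have [/eqP ->|sNu] := boolP (s == u); apply/leifP; first by apply/eqP; field.
have : 0 < (s - u) ^+ 2 by rewrite exprn_even_gt0// subr_eq0.
by rewrite !expr2; lra.
Qed.

Lemma Xi_leif x z : (forall i, 0 < tau z i) ->
  Xi x z <= Pi x ?= iff (z == dual_of x).
Proof.
move=> tau_gt0.
pose u i := 2^-1 * quad (A i) x - alpha i.
pose v j := 2^-1 * quad (B j) x - beta j.
have quadGE : 2^-1 * quad (G z) x = \sum_(i < p) tau z i * (2^-1 * quad (A i) x)
    + \sum_(j < r) sigma z j * (2^-1 * quad (B j) x) - 2^-1 * quad C x.
  rewrite /Gmx 2!quadDmx quadNmx !quad_summx !mulrDr mulrN !mulr_sumr.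
  by congr (_ + _ - _); apply: eq_bigr => k _; rewrite quadZmx mulrCA.
have -> : Xi x z = \sum_(i < p) (u i * tau z i - (ln (tau z i) - 1) * tau z i)
    + \sum_(j < r) (v j * sigma z j - 2^-1 * sigma z j ^+ 2)
    + (- 2^-1 * quad C x - (f^T *m x) 0 0).
  rewrite /Xi quadGE.
  have -> : \sum_(i < p) (u i * tau z i - (ln (tau z i) - 1) * tau z i) =
      \sum_(i < p) tau z i * (2^-1 * quad (A i) x)
      - \sum_(i < p) (alpha i + ln (tau z i) - 1) * tau z i.
    by rewrite -sumrB; apply: eq_bigr => i _; rewrite /u; ring.
  have -> : \sum_(j < r) (v j * sigma z j - 2^-1 * sigma z j ^+ 2) =
      \sum_(j < r) sigma z j * (2^-1 * quad (B j) x)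
      - \sum_(j < r) (2^-1 * sigma z j ^+ 2 + beta j * sigma z j).
    by rewrite -sumrB; apply: eq_bigr => i _; rewrite /v; ring.
  by ring.
have -> : Pi x = \sum_(i < p) expR (u i) + \sum_(j < r) 2^-1 * v j ^+ 2
    + (- 2^-1 * quad C x - (f^T *m x) 0 0) by rewrite /primal; ring.
(* The equality condition is split to match the three summands; [true] belongs to the part common to
   both sides. *)
have -> : (z == dual_of x) =
    [forall i : 'I_p, tau z i == expR (u i)]
    && [forall j : 'I_r, sigma z j == v j] && true.
  rewrite andbT; apply/eqP/andP => [->|[/forallP zt /forallP zs]].
    by split; apply/forallP => k; rewrite ?tau_dual_of ?sigma_dual_of.
  by apply: eq_dual => k; rewrite ?tau_dual_of ?sigma_dual_of; apply/eqP.
apply: leifD; last exact/leif_refl.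
apply: leifD; apply: leif_sum => k _; last exact: fenchel_sqr.
exact: fenchel_expR.
Qed.

Lemma tau_dual_of_gt0 x i : 0 < tau (dual_of x) i.
Proof. by rewrite tau_dual_of expR_gt0. Qed.

Lemma Xi_le x z : (forall i, 0 < tau z i) -> Xi x z <= Pi x.
Proof. by move=> /(Xi_leif x)[]. Qed.

Lemma Xi_dual_of x : Xi x (dual_of x) = Pi x.
Proof. by apply/eqP; rewrite (Xi_leif x (tau_dual_of_gt0 x)). Qed.

(** Completing the square around the stationary point [invmx (G z) *m f]. The sign of the remaining
    form decides between [Xi_le_dual] and [dual_le_Xi]. *)
Lemma Xi_dualE x z : G z \in unitmx ->
  Xi x z = Pid z + 2^-1 * quad (G z) (x - invmx (G z) *m f).
Proof.
move=> Gu; set y := invmx (G z) *m f.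
have fE : f = G z *m y by rewrite mulKVmx.
have fT : f^T = y^T *m G z by rewrite fE trmx_mul (symmx_tr (symG z)).
have qf : quad (invmx (G z)) f = quad (G z) y.
  by rewrite /quad -mulmxA -/y fT.
have fx : (f^T *m x) 0 0 = bil (G z) y x by rewrite fT.
have symGz := symG z.
rewrite /Xi /dual qf fx quadD// bilNl quadN.
by move: (quad _ x) (quad _ y) (bil _ _ _) (\sum_(i < p) _) (\sum_(j < r) _) => *; field.
Qed.

Lemma invmx_solve (M : 'M[R]_n) y : M \in unitmx -> M *m y = f -> invmx M *m f = y.
Proof. by move=> Mu <-; rewrite mulKmx. Qed.

Lemma cvg_dual_of (T : Type) (F : set_system T) {FF : Filter F}
    (x : T -> 'cV[R]_n) (y : 'cV[R]_n) :
  x t @[t --> F] --> y -> dual_of (x t) @[t --> F] --> dual_of y.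
Proof.
move=> cvx.
have cvq M : 2^-1 * quad M (x t) @[t --> F] --> 2^-1 * quad M y.
  apply: cvgM; first exact: cvg_cst.
  by apply: (@cvg_quad _ _ _ F _ (fun=> M)) => //; exact: cvg_cst.
apply: cvg_mx => k j; rewrite ord1 {j}; case: (split_ordP k) => [i ->|j ->].
  under eq_cvg do rewrite -tauE tau_dual_of; rewrite -tauE tau_dual_of.
  have cvu : 2^-1 * quad (A i) (x t) - alpha i @[t --> F] -->
      2^-1 * quad (A i) y - alpha i.
    by apply: cvgB; [exact: cvq | exact: cvg_cst].
  exact: (cvg_comp _ _ cvu (@continuous_expR R _)).
under eq_cvg do rewrite -sigmaE sigma_dual_of; rewrite -sigmaE sigma_dual_of.
by apply: cvgB; [exact: cvq | exact: cvg_cst].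
Qed.

Lemma cvg_primal_of (T : Type) (F : set_system T) {FF : Filter F}
    (z : T -> 'cV[R]_(p + r)) (w : 'cV[R]_(p + r)) : G w \in unitmx ->
  z t @[t --> F] --> w -> invmx (G (z t)) *m f @[t --> F] --> invmx (G w) *m f.
Proof.
move=> Gu cvz; apply: cvg_mulmx; last exact: cvg_cst.
by apply: cvg_invmx => //; exact: cvg_Gmx.
Qed.

Lemma near_Sa_neg z : (0 < n)%N -> Sa_neg A B C z ->
  \forall w \near z, Sa_neg A B C w.
Proof.
move=> n_gt0 [[tau_gt0 _] negG].
have negw : \forall w \near z, negdefmx (G w).
  by apply: (@near_negdefmx _ _ _ (nbhs z) _ G (G z)) => //;
    [exact: symG | apply: (@cvg_Gmx _ (nbhs z)); exact: cvg_id].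
have tauw : \forall w \near z, forall i, 0 < tau w i.
  apply: (@filter_forall _ _ _ (nbhs z)) => i.
  have cvt : tau w i @[w --> z] --> tau z i.
    rewrite tauE; under eq_cvg do rewrite tauE.
    by apply: (@cvg_mx_entry _ _ (nbhs z)); exact: cvg_id.
  by near=> w; near: w; exact: cvgr_gt cvt _ (tau_gt0 i).
near=> w.
have negGw : negdefmx (G w) by near: w.
split => //; split; first by near: w.
by have := negdefmx_unit negGw; rewrite unitmxE unitfE.
Unshelve. all: by end_near. Qed.

(** * The gradient of the dual function and its critical points *)

Lemma is_derive_quad_invmx z v : G z \in unitmx ->
  is_derive z v (fun w => quad (invmx (G w)) f)
    (- quad (\sum_k v k 0 *: ABmx k) (invmx (G z) *m f)).
Proof.
move=> Gu; set Dv := \sum_k _; pose y w := invmx (G w) *m f.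
have qE w : quad (invmx (G w)) f = (f^T *m y w) 0 0 by rewrite /quad mulmxA.
have fE w : G w \in unitmx -> f = G w *m y w by move=> ?; rewrite mulKVmx.
have fTE w : G w \in unitmx -> f^T = (y w)^T *m G w.
  by move=> ?; rewrite {1}(fE w)// trmx_mul (symmx_tr (symG w)).
pose s h := - bil Dv (y (h *: v + z)) (y z).
have cvz : h *: v + z @[h --> (0 : R)] --> z.
  rewrite -[X in _ --> X]add0r -[X in _ --> X + _](scale0r v).
  apply: cvgD; last exact: cvg_cst.
  by apply: cvgZ; [exact: cvg_id | exact: cvg_cst].
have -> : - quad Dv (invmx (G z) *m f) = s 0 by rewrite /s scale0r add0r.
apply: is_derive_line.
  have detG : \forall h \near (0 : R), \det (G (h *: v + z)) != 0.
    have cvdet : \det (G (h *: v + z)) @[h --> (0 : R)] --> \det (G z).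
      by apply: cvg_det; exact: cvg_Gmx.
    by apply: cvgr_neq0 cvdet _; rewrite -unitfE -unitmxE.
  near=> h.
  have Ghu : G (h *: v + z) \in unitmx by rewrite unitmxE unitfE; near: h.
  have GhE : G (h *: v + z) = G z + h *: Dv.
    rewrite addrC GmxD; congr (_ + _); rewrite scaler_sumr.
    by apply: eq_bigr => k _; rewrite mxE scalerA.
  (* Writing [f] as [G z *m y z] in one term and as [G (h *: v + z) *m yh] in the other, the
     increment is exactly [- h * bil Dv yh (y z)], without differentiating the inverse. *)
  rewrite !qE /s; set yh := y (h *: v + z).
  have -> : (f^T *m yh) 0 0 = bil (G z) yh (y z).
    by rewrite (fTE _ Gu) bilC//; exact: symG.
  have -> : (f^T *m y z) 0 0 = bil (G z) yh (y z) + h * bil Dv yh (y z).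
    by rewrite (fTE _ Ghu) -bilZmx -bilDmx -GhE.
  by move: (bil _ _ _) (bil _ _ _) => *; ring.
rewrite /s; apply: cvgN; apply: cvg_mx_entry.
apply: cvg_mulmx; last exact: cvg_cst.
apply: cvg_mulmx; last exact: cvg_cst.
rewrite scale0r add0r; apply: cvg_trmx; exact: cvg_primal_of.
Unshelve. all: by end_near. Qed.

Lemma is_derive_dual z v : Sa A B C z ->
  is_derive z v Pid
    (2^-1 * quad (\sum_k v k 0 *: ABmx k) (invmx (G z) *m f)
     - \sum_(i < p) v (lshift r i) 0 * (alpha i + ln (tau z i))
     - \sum_(j < r) v (rshift p j) 0 * (sigma z j + beta j)).
Proof.
move=> [tau_gt0 detG].
have Gu : G z \in unitmx by rewrite unitmxE unitfE.
pose th i t : R := (alpha i + ln t - 1) * t.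
pose et j s : R := 2^-1 * s ^+ 2 + beta j * s.
have -> : Pid = - (2^-1 \*: (fun w => quad (invmx (G w)) f))
    - \sum_(i < p) (fun w : 'cV[R]_(p + r) => th i (w (lshift r i) 0))
    - \sum_(j < r) (fun w : 'cV[R]_(p + r) => et j (w (rshift p j) 0)).
  apply/funext => w; rewrite /dual !fct_sumE /=.
  congr (_ - _ - _); apply: eq_bigr => k _; first by rewrite tauE.
  by rewrite sigmaE.
(* The product rule produces [t / t], which cancels the [- 1] of [th]. *)
have dth i : is_derive (z (lshift r i) 0) 1 (th i) (alpha i + ln (tau z i)).
  have t_gt0 : 0 < z (lshift r i) 0 by rewrite -tauE.
  have -> : th i = (cst (alpha i - 1) + @ln R) * id.
    by apply/funext => t; rewrite /th /= addrAC.
  have dln := is_derive1_ln t_gt0.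
  apply: is_derive_eq.
  by rewrite !fctE /GRing.scale /= add0r divff ?gt_eqF// tauE; ring.
have det j : is_derive (z (rshift p j) 0) 1 (et j) (sigma z j + beta j).
  have -> : et j = 2^-1 \*: (id ^+ 2) + beta j \*: id.
    by apply/funext => t.
  by apply: is_derive_eq; rewrite sigmaE /GRing.scale /=; field.
have dq := is_derive_quad_invmx v Gu.
have dths i := is_derive_entry v (dth i).
have dets j := is_derive_entry v (det j).
apply: is_derive_eq.
by rewrite /GRing.scale /=; ring.
Qed.

(** Each partial derivative involves a single coordinate besides [y]: its vanishing expresses
    [ln (tau z k)] or [sigma z k] through the quadratic form of [A k] or [B k] at [y]. *)
Lemma critical_dual_of z : dual_critical A B C f alpha beta z ->
  z = dual_of (invmx (G z) *m f).
Proof.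
move=> [Saz grad0].
set y := invmx (G z) *m f.
have partial0 k : 'D_(delta_mx k 0) Pid z = 0.
  by have /colP/(_ k) := grad0; rewrite !mxE.
have quad_delta k : \sum_l (delta_mx k 0 : 'cV[R]_(p + r)) l 0 *: ABmx l = ABmx k.
  rewrite (bigD1 k)//= big1 ?addr0 => [|l lk]; first by rewrite mxE !eqxx scale1r.
  by rewrite mxE (negPf lk) scale0r.
have sum_delta m (h : 'I_m -> 'I_(p + r)) (g : 'I_m -> R) i : injective h ->
    \sum_l (delta_mx (h i) 0 : 'cV[R]_(p + r)) (h l) 0 * g l = g i.
  move=> hinj; rewrite (bigD1 i)//= big1 ?addr0 => [|l li].
    by rewrite mxE !eqxx mul1r.
  by rewrite mxE (inj_eq hinj) (negPf li) mul0r.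
have sum_delta0 m (h : 'I_m -> 'I_(p + r)) (g : 'I_m -> R) k :
    (forall l, h l != k) -> \sum_l (delta_mx k 0 : 'cV[R]_(p + r)) (h l) 0 * g l = 0.
  by move=> hk; apply: big1 => l _; rewrite mxE (negPf (hk l)) mul0r.
have tau_gt0 := Saz.1.
apply: eq_dual => k; rewrite ?tau_dual_of ?sigma_dual_of.
  have := partial0 (lshift r k).
  rewrite (derive_val (is_derive := is_derive_dual _ Saz)) quad_delta ABmx_lshift.
  rewrite (sum_delta _ (@lshift p r)); last exact: lshift_inj.
  rewrite (sum_delta0 _ (@rshift p r)) => [|l]; last by rewrite eq_rlshift.
  rewrite subr0 -/y => /subr0_eq ->.
  by rewrite addrAC subrr add0r lnK// posrE.
have := partial0 (rshift p k).
rewrite (derive_val (is_derive := is_derive_dual _ Saz)) quad_delta ABmx_rshift.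
rewrite (sum_delta _ (@rshift p r)); last exact: rshift_inj.
rewrite (sum_delta0 _ (@lshift p r)) => [|l]; last by rewrite eq_lrshift.
by rewrite subr0 -/y => /subr0_eq ->; rewrite addrK.
Qed.

(** * Weak duality for definite [G z], and the positivity criterion *)

Lemma Xi_le_dual x z : G z \in unitmx -> negdefmx (G z) -> Xi x z <= Pid z.
Proof.
move=> Gu [_ negG]; rewrite Xi_dualE// gerDl.
have [->|d0] := eqVneq (x - invmx (G z) *m f) 0.
  by rewrite /quad mulmx0 mxE mulr0.
by have := negG _ d0; lra.
Qed.

Lemma dual_le_Xi x z : posdefmx (G z) -> Pid z <= Xi x z.
Proof.
move=> posG; rewrite Xi_dualE ?posdefmx_unit// lerDl.
have [->|d0] := eqVneq (x - invmx (G z) *m f) 0.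
  by rewrite /quad mulmx0 mxE mulr0.
by have := posG.2 _ d0; lra.
Qed.

Lemma Xi_primal_of z : G z \in unitmx -> Xi (invmx (G z) *m f) z = Pid z.
Proof. by move=> Gu; rewrite Xi_dualE// subrr /quad mulmx0 mxE mulr0 addr0. Qed.

Lemma XiD x v z t : Xi (x + t *: v) z =
  Xi x z + t * (bil (G z) x v - (f^T *m v) 0 0) + 2^-1 * t ^+ 2 * quad (G z) v.
Proof.
rewrite /Xi quadD; last exact: symG.
rewrite quadZ bilZl bilC; last exact: symG.
rewrite mulmxDr -scalemxAr [(f^T *m x + _) 0 0]mxE [(t *: (f^T *m v)) 0 0]mxE.
by move: (quad _ x) (quad _ v) (bil _ _ _) (\sum_(i < p) _) (\sum_(j < r) _)
  ((_ *m x) 0 0) ((_ *m v) 0 0) => *; field.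
Qed.

(** Rayleigh bounds, term by term, give [Delta A B C z * quad 1%:M x <= quad (G z) x]. A nonpositive
    [sigma z j] reverses the bound on [B j], which is why [Delta] then takes its largest
    eigenvalue. *)
Lemma posdef_Delta z : (0 < n)%N -> (forall i, 0 < tau z i) ->
  0 < Delta A B C z -> posdefmx (G z).
Proof.
move=> n_gt0 tau_gt0 Delta_gt0; split; first exact: symG.
move=> x x0; have q0 := quad_mx1_gt0 x0.
apply: lt_le_trans (mulr_gt0 Delta_gt0 q0) _.
rewrite /Delta /Gmx mulrDl mulrDl mulNr 2!quadDmx quadNmx !quad_summx !mulr_suml.
apply: lerD; last by rewrite lerN2 rayleigh_max.
apply: lerD; apply: ler_sum => k _; rewrite quadZmx -mulrA.
  by apply: ler_wpM2l; [exact: ltW | exact: (rayleigh n_gt0 (symA k)).2].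
case: ltP => sk.
  by apply: ler_wpM2l; [exact: ltW | exact: (rayleigh n_gt0 (symB k)).2].
by rewrite ler_wnM2l// rayleigh_max.
Qed.

(** * Transfer of extrema at a critical point *)

Section critical_point.
Variable zb : 'cV[R]_(p + r).
Hypothesis n_gt0 : (0 < n)%N.
Hypothesis critzb : dual_critical A B C f alpha beta zb.
Let xb := invmx (G zb) *m f.

Let Gu : G zb \in unitmx.
Proof. by have [[_]] := critzb; rewrite unitmxE unitfE. Qed.

Let zbE : dual_of xb = zb.
Proof. by rewrite -critical_dual_of. Qed.

Let Gxb : G zb *m xb = f.
Proof. by rewrite mulKVmx. Qed.

(** Both values equal [Xi xb zb], since [zb] is optimal for [xb] and [xb] is stationary for [zb]. *)
Lemma primal_dual_crit : Pi xb = Pid zb.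
Proof. by rewrite -Xi_dual_of zbE Xi_primal_of. Qed.

Let cv_dual_of : dual_of x @[x --> xb] --> zb.
Proof.
rewrite -[X in _ --> X]zbE.
by apply: (@cvg_dual_of _ (nbhs xb)); exact: cvg_id.
Qed.

Let cv_primal_of : invmx (G z) *m f @[z --> zb] --> xb.
Proof. by apply: (@cvg_primal_of _ (nbhs zb)) => //; exact: cvg_id. Qed.

(** [Pid zb <= Xi x zb <= Pi x] for every [x], and [Pid z <= Xi xb z <= Pi xb] for every [z] in
    [Sa_pos]; [primal_dual_crit] closes both chains. *)
Lemma min_max_duality : 0 < Delta A B C zb ->
  is_min_value Pi setT (Pi xb) /\ is_max_value Pid (Sa_pos A B C) (Pid zb).
Proof.
move=> Delta_gt0; have [[tau_gt0 detG] _] := critzb.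
have posG := posdef_Delta n_gt0 tau_gt0 Delta_gt0.
split; split.
- by exists xb.
- move=> _ [x _ <-]; rewrite primal_dual_crit (le_trans _ (Xi_le x tau_gt0))//.
  exact: dual_le_Xi.
- by exists zb => //; split.
- move=> _ [z [[tz _] posz] <-].
  by rewrite -primal_dual_crit (le_trans (dual_le_Xi xb posz))// Xi_le.
Qed.

Hypothesis negzb : Sa_neg A B C zb.

(** [Sa] is a neighbourhood of [zb], so extremality relative to [Sa] is plain local extremality. *)
Lemma within_Sa (P : set 'cV[R]_(p + r)) :
  (\forall z \near within (Sa A B C) (nbhs zb), P z) -> \forall z \near zb, P z.
Proof.
move=> nearP; apply: filterS2 (near_Sa_neg n_gt0 negzb) nearP => z [Saz _].
exact.
Qed.

Let Sa_negP z : Sa_neg A B C z ->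
  [/\ forall i, 0 < tau z i, G z \in unitmx & negdefmx (G z)].
Proof. by move=> [[tz _] negz]; split => //; exact: negdefmx_unit. Qed.

(** With [x = invmx (G z) *m f], which is close to [xb]: [Pid z = Xi x z <= Pi x <= Pi xb]. *)
Lemma dual_locmax : (\forall x \near xb, Pi x <= Pi xb) ->
  \forall z \near zb, Pid z <= Pid zb.
Proof.
move=> /cv_primal_of max_xb; have nearneg := near_Sa_neg n_gt0 negzb.
near=> z.
have [tz Gz _] : [/\ forall i, 0 < tau z i, G z \in unitmx & negdefmx (G z)].
  by apply: Sa_negP; near: z.
rewrite -Xi_primal_of// -primal_dual_crit (le_trans (Xi_le _ tz))//.
by near: z.
Unshelve. all: by end_near. Qed.

(** With [z = dual_of x], which is close to [zb]: [Pi x = Xi x z <= Pid z <= Pid zb]. *)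
Lemma primal_locmax : (\forall z \near zb, Pid z <= Pid zb) ->
  \forall x \near xb, Pi x <= Pi xb.
Proof.
move=> /cv_dual_of max_zb; have /cv_dual_of nearneg := near_Sa_neg n_gt0 negzb.
near=> x.
have [_ Gz negz] : [/\ forall i, 0 < tau (dual_of x) i,
    G (dual_of x) \in unitmx & negdefmx (G (dual_of x))].
  by apply: Sa_negP; near: x.
rewrite -Xi_dual_of primal_dual_crit (le_trans (Xi_le_dual _ Gz negz))//.
by near: x.
Unshelve. all: by end_near. Qed.

Let cv_line m (x v : 'cV[R]_m) : x + t *: v @[t --> (0 : R)^'] --> x.
Proof.
have cv0 : x + t *: v @[t --> (0 : R)] --> x + (0 : R) *: v.
  apply: cvgD; first exact: cvg_cst.
  by apply: cvgZ; [exact: cvg_id | exact: cvg_cst].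
rewrite scale0r addr0 in cv0.
by move=> P /cv0; exact: nbhs_dnbhs.
Qed.

(* Along a direction v of the kernel, zeta(xb + t v) -> zb, and
   Pi(xb + t v) - Pi xb <= t^2 v^T G(zeta(xb + t v)) v / 2 < 0. *)
Lemma jac_inj_of_primal_locmin : (\forall x \near xb, Pi xb <= Pi x) ->
  forall v : 'cV[R]_n, jac_mx ABmx xb *m v = 0 -> v = 0.
Proof.
move=> min_xb v Jv0; apply: contrapT => /eqP v0.
have [t t_neq0 [min_t neg_t]] : exists2 t : R, t != 0 &
    Pi xb <= Pi (xb + t *: v) /\ Sa_neg A B C (dual_of (xb + t *: v)).
  have /cv_dual_of nearneg := near_Sa_neg n_gt0 negzb.
  have /cv_line min_t := min_xb.
  have /cv_line neg_t := nearneg.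
  near (0 : R)^' => t; exists t; first by near: t; exact: nbhs_dnbhs_neq.
  by split; near: t; [exact: min_t | exact: neg_t].
have [tz _ negz] := Sa_negP neg_t; set z := dual_of _ in neg_t tz negz.
(* No first-order term: [G zb *m xb = f], and [G z - G zb] is a combination of the [ABmx k], whose
   forms vanish at [(xb, v)]. *)
have bil0 : bil (G z) xb v - (f^T *m v) 0 0 = 0.
  have -> : (f^T *m v) 0 0 = bil (G zb) xb v.
    by rewrite -Gxb trmx_mul (symmx_tr (symG zb)).
  have -> : G z = G zb + \sum_k (z - zb) k 0 *: ABmx k.
    by rewrite -GmxD addrC subrK.
  rewrite bilDmx addrAC subrr add0r bil_summx.
  apply: big1 => k _; rewrite bilZmx.
  have /colP/(_ k) := Jv0; rewrite jac_mxE mxE => bilk0.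
  by rewrite bilC ?bilk0 ?mulr0//; exact: symAB.
have := XiD xb v z t; rewrite Xi_dual_of bil0 mulr0 addr0 => PiE.
have := Xi_le xb tz; have := negz.2 _ v0.
have : 0 < t ^+ 2 by rewrite exprn_even_gt0.
by move: min_t; rewrite PiE; nra.
Unshelve. all: by end_near. Qed.

(* A direction eta of the kernel leaves G(zb + t eta) xb = f, so that
   Pid(zb + t eta) = Xi xb (zb + t eta) < Pi xb. *)
Lemma jacT_inj_of_dual_locmin : (\forall z \near zb, Pid zb <= Pid z) ->
  forall eta : 'cV[R]_(p + r), (jac_mx ABmx xb)^T *m eta = 0 -> eta = 0.
Proof.
move=> min_zb eta; rewrite jac_mx_tr => Jeta0; apply: contrapT => /eqP eta0.
have [t t_neq0 [min_t neg_t]] : exists2 t : R, t != 0 &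
    Pid zb <= Pid (zb + t *: eta) /\ Sa_neg A B C (zb + t *: eta).
  have /cv_line neg_t := near_Sa_neg n_gt0 negzb.
  have /cv_line min_t := min_zb.
  near (0 : R)^' => t; exists t; first by near: t; exact: nbhs_dnbhs_neq.
  by split; near: t; [exact: min_t | exact: neg_t].
have [tz Gz _] := Sa_negP neg_t; set z := zb + t *: eta in neg_t min_t tz Gz.
have xbE : invmx (G z) *m f = xb.
  apply: invmx_solve => //; rewrite GmxD mulmxDl Gxb.
  rewrite (_ : \sum_k _ = t *: \sum_k eta k 0 *: ABmx k).
    by rewrite -scalemxAl Jeta0 scaler0 addr0.
  by rewrite scaler_sumr; apply: eq_bigr => k _; rewrite mxE scalerA.
(* The inequality is strict because [z] differs from [zb = dual_of xb]. *)
have : Xi xb z < Pi xb.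
  rewrite (lt_leif (Xi_leif xb tz)) zbE /z -subr_eq0 addrC addKr.
  by rewrite scaler_eq0 negb_or t_neq0.
by rewrite -[in Xi _ _]xbE Xi_primal_of// primal_dual_crit ltNge min_t.
Unshelve. all: by end_near. Qed.

(** Every [z] near [zb] is [dual_of x] for some [x] with [Pi xb <= Pi x], by [quad_map_open]; then
    [Pi x = Xi x z <= Pid z]. *)
Lemma dual_locmin : (p + r)%N = n -> (\forall x \near xb, Pi xb <= Pi x) ->
  \forall z \near zb, Pid zb <= Pid z.
Proof.
move=> pr_n min_xb.
have /row_freeP[W JW] := row_free_of_inj pr_n (jac_inj_of_primal_locmin min_xb).
(* [quad_map ABmx x = y z] says [dual_of x = z]. The entries are [ln tau + alpha] and
   [sigma + beta], written as offsets from [zb] to make the limit at [zb] visible. *)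
pose y z : 'cV[R]_(p + r) := quad_map ABmx xb + col_mx
  (\col_i (ln (tau z i) - ln (tau zb i))) (\col_j (sigma z j - sigma zb j)).
have nearneg := near_Sa_neg n_gt0 negzb.
have cvy : y z @[z --> zb] --> quad_map ABmx xb.
  rewrite -[X in _ --> X]addr0; apply: (@cvgD _ _ _ (nbhs zb)); first exact: cvg_cst.
  apply: (@cvg_mx _ _ (nbhs zb)) => k j; rewrite ord1 mxE {j}.
  have cvid k' : (fun z : 'cV[R]_(p + r) => z k' 0) @ zb --> zb k' 0.
    by apply: (@cvg_mx_entry _ _ (nbhs zb)); exact: cvg_id.
  have cvB0 (g : 'cV[R]_(p + r) -> R) l :
      g @ zb --> l -> g z - l @[z --> zb] --> (0 : R).
    move=> cvgl; rewrite -[X in _ --> X](subrr l).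
    by apply: (@cvgB _ _ _ (nbhs zb)) => //; exact: cvg_cst.
  case: (split_ordP k) => [i ->|j ->].
    under eq_cvg do rewrite col_mxEu mxE !tauE.
    have cvln : (fun z : 'cV[R]_(p + r) => ln (z (lshift r i) 0)) @ zb -->
        ln (zb (lshift r i) 0).
      apply: (cvg_comp _ _ (cvid _) (continuous_ln _)).
      by rewrite -tauE; have [] := Sa_negP negzb.
    exact: cvB0 cvln.
  under eq_cvg do rewrite col_mxEd mxE !sigmaE.
  exact: cvB0 (cvid _).
have onto := cvy _ (quad_map_open symAB JW min_xb).
near=> z.
have [tz Gz negz] : [/\ forall i, 0 < tau z i, G z \in unitmx & negdefmx (G z)].
  by apply: Sa_negP; near: z.
have [x min_x xy] : exists2 x, Pi xb <= Pi x & quad_map ABmx x = y z by near: z.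
have zE : dual_of x = z.
  apply: eq_dual => k; rewrite ?tau_dual_of ?sigma_dual_of.
    have tb : tau zb k = expR (2^-1 * quad (A k) xb - alpha k).
      by rewrite -[in LHS]zbE tau_dual_of.
    have /colP/(_ (lshift r k)) := xy.
    rewrite [RHS]mxE col_mxEu !quad_mapE ABmx_lshift mxE tb expRK => ->.
    by rewrite -[RHS]lnK ?posrE//; congr expR; ring.
  have sb : sigma zb k = 2^-1 * quad (B k) xb - beta k.
    by rewrite -[in LHS]zbE sigma_dual_of.
  have /colP/(_ (rshift p k)) := xy.
  by rewrite [RHS]mxE col_mxEd !quad_mapE ABmx_rshift mxE sb => ->; ring.
rewrite -primal_dual_crit (le_trans min_x)// -Xi_dual_of zE.
exact: Xi_le_dual.
Unshelve. all: by end_near. Qed.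

(* G(z) x = f is linear in z: z = zb + eta solves it as soon as
   (jac_mx x)^T eta = f - G(zb) x. *)
Lemma primal_locmin : (p + r)%N = n -> (\forall z \near zb, Pid zb <= Pid z) ->
  \forall x \near xb, Pi xb <= Pi x.
Proof.
move=> pr_n min_zb.
have /row_freeP[W JW] :=
  row_free_of_inj (esym pr_n) (jacT_inj_of_dual_locmin min_zb).
(* The correction [eta] is sought in the range of [W]: its coefficient matrix [N x] tends to the
   identity at [xb], hence is invertible nearby. *)
pose N x := (jac_mx ABmx x)^T *m W.
pose z x := zb + W *m (invmx (N x) *m (f - G zb *m x)).
have cvN : N x @[x --> xb] --> (1%:M : 'M[R]_n).
  rewrite -[X in _ --> X]JW; apply: (@cvg_mulmx _ _ (nbhs xb)); last exact: cvg_cst.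
  by apply: cvg_trmx; apply: (@cvg_jac_mx _ _ _ _ _ (nbhs xb)); exact: cvg_id.
have Nu : \forall x \near xb, N x \in unitmx.
  have detN : \forall x \near xb, \det (N x) != 0.
    by apply: cvgr_neq0 (cvg_det cvN) _; rewrite det1 oner_eq0.
  by apply: filterS detN => x; rewrite unitmxE unitfE.
have cvz : z x @[x --> xb] --> zb.
  have zbE' : zb + W *m (invmx 1%:M *m (f - G zb *m xb)) = zb.
    by rewrite Gxb subrr !mulmx0 addr0.
  rewrite -[X in _ --> X]zbE'; apply: (@cvgD _ _ _ (nbhs xb)); first exact: cvg_cst.
  apply: (@cvg_mulmx _ _ (nbhs xb)); first exact: cvg_cst.
  apply: (@cvg_mulmx _ _ (nbhs xb)); first by apply: cvg_invmx => //; exact: unitmx1.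
  apply: (@cvgB _ _ _ (nbhs xb)); first exact: cvg_cst.
  by apply: (@cvg_mulmx _ _ (nbhs xb)); [exact: cvg_cst | exact: cvg_id].
have /cvz min_zx := min_zb; have /cvz neg_zx := near_Sa_neg n_gt0 negzb.
near=> x.
have [tz Gz _] : [/\ forall i, 0 < tau (z x) i, G (z x) \in unitmx & negdefmx (G (z x))].
  by apply: Sa_negP; near: x.
have xE : invmx (G (z x)) *m f = x.
  apply: invmx_solve => //; rewrite GmxD mulmxDl -jac_mx_tr mulmxA -/(N x).
  by rewrite mulKVmx ?[G zb *m x + _]addrC ?subrK//; near: x.
have min_z : Pid zb <= Pid (z x) by near: x.
rewrite primal_dual_crit (le_trans min_z)// -Xi_primal_of// xE.
exact: Xi_le.
Unshelve. all: by end_near. Qed.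

Lemma max_neighborhoods : (\forall x \near xb, Pi x <= Pi xb) ->
  (\forall z \near zb, Pid z <= Pid zb) ->
  exists (X0 : set 'cV[R]_n) (S0 : set 'cV[R]_(p + r)),
    [/\ nbhs xb X0, nbhs zb S0 & S0 `<=` Sa_neg A B C] /\
    [/\ is_max_value Pi X0 (Pi xb), is_max_value Pid S0 (Pid zb) & Pi xb = Pid zb].
Proof.
move=> max_xb max_zb.
(* The sets where the inequalities hold are themselves neighbourhoods, by local maximality. *)
exists [set x | Pi x <= Pi xb], ([set z | Pid z <= Pid zb] `&` Sa_neg A B C).
split; split.
- exact: max_xb.
- by apply: filterI => //; exact: near_Sa_neg.
- exact: subIsetr.
- by split; [exists xb => /= | move=> _ [x /= ? <-]].
- by split; [exists zb => //; split => /= | move=> _ [z /= [? _] <-]].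
- exact: primal_dual_crit.
Qed.

Lemma min_neighborhoods : (\forall x \near xb, Pi xb <= Pi x) ->
  (\forall z \near zb, Pid zb <= Pid z) ->
  exists (X0 : set 'cV[R]_n) (S0 : set 'cV[R]_(p + r)),
    [/\ nbhs xb X0, nbhs zb S0 & S0 `<=` Sa_neg A B C] /\
    [/\ is_min_value Pi X0 (Pi xb), is_min_value Pid S0 (Pid zb) & Pi xb = Pid zb].
Proof.
move=> min_xb min_zb.
exists [set x | Pi xb <= Pi x], ([set z | Pid zb <= Pid z] `&` Sa_neg A B C).
split; split.
- exact: min_xb.
- by apply: filterI => //; exact: near_Sa_neg.
- exact: subIsetr.
- by split; [exists xb => /= | move=> _ [x /= ? <-]].
- by split; [exists zb => //; split => /= | move=> _ [z /= [? _] <-]].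
- exact: primal_dual_crit.
Qed.

End critical_point.

End canonical_duality.

Theorem theorem2 (R : realType) (n p r : nat)
    (n_gt0 : (0 < n)%N) (p_gt0 : (0 < p)%N) (r_gt0 : (0 < r)%N)
    (A : 'I_p -> 'M[R]_n) (B : 'I_r -> 'M[R]_n) (C : 'M[R]_n)
    (f : 'cV[R]_n) (alpha : 'I_p -> R) (beta : 'I_r -> R)
    (symA : forall i, A i \is symmetricmx)
    (posB : forall j, posdefmx (B j))
    (posC : posdefmx C)
    (zb : 'cV[R]_(p + r)) (xb : 'cV[R]_n)
    (critzb : dual_critical A B C f alpha beta zb)
    (xbE : xb = invmx (Gmx A B C zb) *m f) :
  let Pi := primal A B C f alpha beta in
  let Pid := dual A B C f alpha beta in
  [/\ (0 < Delta A B C zb ->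
        [/\ is_min_value Pi setT (Pi xb),
            is_max_value Pid (Sa_pos A B C) (Pid zb)
          & Pi xb = Pid zb]),
      (Sa_neg A B C zb ->
        local_maximizer Pi setT xb \/ local_maximizer Pid (Sa A B C) zb ->
        exists (X0 : set 'cV[R]_n) (S0 : set 'cV[R]_(p + r)),
          [/\ nbhs xb X0, nbhs zb S0 & S0 `<=` Sa_neg A B C] /\
          [/\ is_max_value Pi X0 (Pi xb),
              is_max_value Pid S0 (Pid zb)
            & Pi xb = Pid zb])
    & (Sa_neg A B C zb -> (p + r)%N = n ->
        local_minimizer Pi setT xb \/ local_minimizer Pid (Sa A B C) zb ->
        exists (X0 : set 'cV[R]_n) (S0 : set 'cV[R]_(p + r)),
          [/\ nbhs xb X0, nbhs zb S0 & S0 `<=` Sa_neg A B C] /\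
          [/\ is_min_value Pi X0 (Pi xb),
              is_min_value Pid S0 (Pid zb)
            & Pi xb = Pid zb])].
Proof.
move=> Pi Pid.
have symB j : B j \is symmetricmx by have [] := posB j.
have symC : C \is symmetricmx by have [] := posC.
have withinT (P : set 'cV[R]_n) :
    (\forall x \near within setT (nbhs xb), P x) -> \forall x \near xb, P x.
  by rewrite withinET.
have PiPid : Pi xb = Pid zb by rewrite xbE; exact: primal_dual_crit.
split; [move=> Delta_gt0 | move=> negzb locmax | move=> negzb pr_n locmin].
- by have [] := min_max_duality symA symB symC n_gt0 critzb Delta_gt0; rewrite -xbE.
(* Whichever side is assumed maximal, the transfer lemmas supply the other, so both are available
   for the neighbourhoods. *)
- have [max_xb max_zb] : (\forall x \near xb, Pi x <= Pi xb) /\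
      (\forall z \near zb, Pid z <= Pid zb).
    case: locmax => [[_ /withinT max_xb]|[_ max_zb]].
      by split => //; apply: dual_locmax => //; rewrite -xbE.
    have {}max_zb : \forall z \near zb, Pid z <= Pid zb.
      exact: within_Sa max_zb.
    by split => //; rewrite xbE; apply: primal_locmax.
  rewrite xbE in max_xb *; exact: max_neighborhoods.
- have [min_xb min_zb] : (\forall x \near xb, Pi xb <= Pi x) /\
      (\forall z \near zb, Pid zb <= Pid z).
    case: locmin => [[_ /withinT min_xb]|[_ min_zb]].
      by split => //; apply: dual_locmin => //; rewrite -xbE.
    have {}min_zb : \forall z \near zb, Pid zb <= Pid z.
      exact: within_Sa min_zb.
    by split => //; rewrite xbE; apply: primal_locmin.
  rewrite xbE in min_xb *; exact: min_neighborhoods.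
Qed.
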